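(* Let $K$ be an algebraic number field of possibly infinite degree. Then there is a dense subset ${\sf P}\subset{\sf N}_\bullet[K]$ such that for all $[F]\in{\sf P}$ there exists $[A]\in{\sf N}_\bullet[O_K]$ with $$[A]\otimes[F]\in{\sf N}_\bullet[O_K].$$
   Context: For a finite extension $K/\mathbb{Q}$ let $\mathbb{S}_K=\mathbb{A}_K/(K,+)$ be the adele class group; for $K/\mathbb{Q}$ infinite algebraic, let $\mathbb{S}_K$ denote here the inverse limit of the groups $\mathbb{A}_{K'}/(K',+)$ over finite subextensions $K'\subset K$ along the maps induced by the field traces. It is a compact abelian group with unit mass Haar measure, and its characters $\phi_\alpha$ are canonically indexed by $\alpha\in K$ with $\phi_\alpha\phi_\beta=\phi_{\alpha+\beta}$. Every $f\in L^2(\mathbb{S}_K,\mathbb{C})$ is $f=\sum_{\alpha\in K}a_\alpha\phi_\alpha$ with $(a_\alpha)\in\ell^2(K)$. The Hilbert space ${\sf H}_\bullet[K]$ of graded-holomorphic functions is identified isometrically, by taking boundary values, with $L^2(\mathbb{S}_K,\mathbb{C})\cong\ell^2(K)$; its elements are written $F=\sum_{\alpha\in K}a_\alpha\boldsymbol\varrho^\alpha$, where $\boldsymbol\varrho^\alpha$ has boundary value $\phi_\alpha$. The Dirichlet product of $F=\sum a_\alpha\boldsymbol\varrho^\alpha$ and $G=\sum b_\alpha\boldsymbol\varrho^\alpha$ is $F\otimes G=\sum_\alpha d_\alpha\boldsymbol\varrho^\alpha$, $d_\alpha=\sum_{\alpha_1\alpha_2=\alpha}a_{\alpha_1}b_{\alpha_2}$,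 defined when the expression $d_0=a_0\sum_{\alpha\ne0}b_\alpha+b_0\sum_{\alpha\ne0}a_\alpha+a_0b_0$ converges absolutely and $(d_\alpha)\in\ell^2(K)$. Let ${\sf I}_K\subset{\sf H}_\bullet[K]$ be the set of $F$ with $(a_\alpha)$ absolutely summable and $\sum a_\alpha=0$. Set ${\sf N}_\bullet[K]=({\sf H}_\bullet[K]\setminus{\sf I}_K)/\mathbb{C}^*$, a subspace of the projectivization $\mathbb{P}{\sf H}_\bullet[K]$ (with its usual topology), with the induced partially defined operation $\otimes$ on classes $[F]$. ${\sf N}_\bullet[O_K]\subset{\sf N}_\bullet[K]$ is the set of classes of series with $a_\alpha=0$ for all $\alpha\notin O_K$, where $O_K$ is the ring of algebraic integers of $K$. *)

(* Defs.v *)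
From HB Require Import structures.
From mathcomp Require Import all_boot all_order all_algebra.
From mathcomp Require Import complex finmap.
From mathcomp Require Import all_classical all_reals all_analysis.
From mathcomp.analysis.showcase Require summability.

Set Implicit Arguments.
Unset Strict Implicit.
Unset Printing Implicit Defensive.
Import Order.TTheory GRing.Theory Num.Theory.
Import numFieldNormedType.Exports.

Local Open Scope classical_set_scope.
Local Open Scope complex_scope.
Local Open Scope quotient_scope.
Local Open Scope ring_scope.

(* The complex modulus, with values in R. *)
Notation cabs := Normc.normc.

Section ell2.
Context {R : realType} {I : choiceType}.
Implicit Types a b : I -> R[i].

Definition abs_summable a : Prop :=
  summable [set: I] (fun i => (cabs (a i))%:E).

(* Unconditional sum: limit in the complex plane of the net of finite partial
   sums; only meaningful when [a] is summable. *)
Definition csum a : R[i] := summability.sum (a : I -> R[i]^o).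

Definition sqnorm a : \bar R := \esum_(i in [set: I]) (cabs (a i) ^+ 2)%:E.

Definition square_summable : {pred (I -> R[i])} :=
  mem [set a | (sqnorm a < +oo)%E].

Definition l2norm a : R := Num.sqrt (fine (sqnorm a)).

Lemma square_summableP a :
  reflect (sqnorm a < +oo)%E (a \in square_summable).
Proof. by apply: (iffP idP); rewrite /square_summable/= inE. Qed.

Lemma sqnorm_ge0 a : (0 <= sqnorm a)%E.
Proof. by apply: esum_ge0 => i _; rewrite lee_fin sqr_ge0. Qed.

Lemma sqnorm_sum_le a (A : set I) : a \in square_summable -> finite_set A ->
  \sum_(i <- fset_set A) cabs (a i) ^+ 2 <= l2norm a ^+ 2.
Proof.
move=> /square_summableP aoo Afin.
have anum : sqnorm a \is a fin_num by rewrite ge0_fin_numE ?sqnorm_ge0.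
rewrite sqr_sqrtr ?fine_ge0 ?sqnorm_ge0// -lee_fin fineK//.
apply: esum_ge; exists A; first by split.
by rewrite fsbig_finite//= sumEFin.
Qed.

Lemma sqnorm_le a (M : R) :
  (forall A : set I, finite_set A ->
     \sum_(i <- fset_set A) cabs (a i) ^+ 2 <= M) ->
  (sqnorm a <= M%:E)%E.
Proof.
move=> aM; apply: ge_ereal_sup => _ [A [Afin _] <-].
by rewrite fsbig_finite//= sumEFin lee_fin aM.
Qed.

Lemma l2norm_le a (M : R) : 0 <= M ->
  (forall A : set I, finite_set A ->
     \sum_(i <- fset_set A) cabs (a i) ^+ 2 <= M ^+ 2) ->
  a \in square_summable /\ l2norm a <= M.
Proof.
move=> M0 /sqnorm_le aM; have aoo := le_lt_trans aM (ltry _).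
split; first exact/square_summableP.
have anum : sqnorm a \is a fin_num by rewrite ge0_fin_numE ?sqnorm_ge0.
by rewrite -(ger0_norm M0) -sqrtr_sqr ler_wsqrtr// -lee_fin fineK.
Qed.

Lemma cabs_ge0 (z : R[i]) : 0 <= cabs z.
Proof. by case: z => x y; rewrite sqrtr_ge0. Qed.

Lemma cabsD (z w : R[i]) : cabs (z + w) <= cabs z + cabs w.
Proof. exact: le_normcD. Qed.

Lemma minkowski_seq a b (r : seq I) :
  Num.sqrt (\sum_(i <- r) cabs (a i + b i) ^+ 2) <=
  Num.sqrt (\sum_(i <- r) cabs (a i) ^+ 2) +
  Num.sqrt (\sum_(i <- r) cabs (b i) ^+ 2).
Proof.
have s0 (f : I -> R[i]) (s : seq I) : 0 <= \sum_(i <- s) cabs (f i) ^+ 2.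
  by apply: sumr_ge0 => i _; rewrite sqr_ge0.
elim: r => [|i r IH]; first by rewrite !big_nil sqrtr0 addr0.
rewrite !big_cons.
pose z (f : I -> R[i]) : R[i] :=
  Complex (cabs (f i)) (Num.sqrt (\sum_(j <- r) cabs (f j) ^+ 2)).
have zE f : Num.sqrt (cabs (f i) ^+ 2 + \sum_(j <- r) cabs (f j) ^+ 2)
    = cabs (z f) by rewrite /= sqr_sqrtr.
rewrite (zE a) (zE b); apply: le_trans (cabsD _ _) => /=.
apply: ler_wsqrtr; rewrite lerD//.
  by rewrite lerXn2r ?nnegrE ?addr_ge0 ?cabs_ge0// cabsD.
rewrite -[leLHS]sqr_sqrtr ?(s0 (fun i => a i + b i))//.
by rewrite lerXn2r ?nnegrE ?addr_ge0 ?sqrtr_ge0.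
Qed.

Lemma l2normD a b : a \in square_summable -> b \in square_summable ->
  (a + b) \in square_summable /\ l2norm (a + b) <= l2norm a + l2norm b.
Proof.
move=> ass bss; apply: l2norm_le => [|A Afin].
  by rewrite addr_ge0 ?sqrtr_ge0.
have s0 (f : I -> R[i]) (s : seq I) : 0 <= \sum_(i <- s) cabs (f i) ^+ 2.
  by apply: sumr_ge0 => i _; rewrite sqr_ge0.
rewrite -[leLHS]sqr_sqrtr ?s0//.
rewrite lerXn2r ?nnegrE ?addr_ge0 ?sqrtr_ge0//.
apply: le_trans (minkowski_seq a b _) _.
have sq f : f \in square_summable ->
    Num.sqrt (\sum_(i <- fset_set A) cabs (f i) ^+ 2) <= l2norm f.
  move=> fss; rewrite -[leRHS]ger0_norm ?sqrtr_ge0// -sqrtr_sqr.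
  by rewrite ler_wsqrtr// sqnorm_sum_le.
by rewrite lerD ?sq.
Qed.

Lemma l2normZ_le (c : R[i]) a : a \in square_summable ->
  (c *: a) \in square_summable /\ l2norm (c *: a) <= cabs c * l2norm a.
Proof.
move=> ass; apply: l2norm_le => [|A Afin].
  by rewrite mulr_ge0 ?cabs_ge0 ?sqrtr_ge0.
under eq_bigr do rewrite Normc.normcM exprMn.
by rewrite -mulr_sumr exprMn ler_wpM2l ?sqr_ge0 ?sqnorm_sum_le.
Qed.

Lemma l2normZ (c : R[i]) a : a \in square_summable ->
  l2norm (c *: a) = cabs c * l2norm a.
Proof.
move=> ass; apply/eqP; rewrite eq_le (l2normZ_le c ass).2 /=.
have [->|c0] := eqVneq c 0; first by rewrite Normc.normc0 mul0r sqrtr_ge0.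
have /(l2normZ_le c^-1)[_] := (l2normZ_le c ass).1.
have cc0 : 0 < cabs c.
  by rewrite lt_neqAle cabs_ge0 andbT eq_sym; apply: contra c0 => /eqP/Normc.eq0_normc->.
rewrite scalerA mulVf// scale1r Normc.normcV => h.
by rewrite -ler_pdivlMl.
Qed.

Lemma l2norm_eq0 a : a \in square_summable -> l2norm a = 0 -> a = 0.
Proof.
move=> ass a0; apply/funext => i; apply: Normc.eq0_normc.
have := sqnorm_sum_le ass (finite_set1 i).
rewrite fset_set1 big_seq_fset1 a0 expr0n/= => h.
by apply/eqP; rewrite -sqrf_eq0 eq_le h sqr_ge0.
Qed.

Lemma square_summable_submod_closed : submod_closed square_summable.
Proof.
split=> [|c a b ass bss]; last first.
  by apply: (l2normD _ bss).1; exact: (l2normZ_le c ass).1.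
apply: (@l2norm_le 0 0 _ _).1 => // A _.
by rewrite big1 ?expr0n// => i _; rewrite Normc.normc0 expr0n.
Qed.

HB.instance Definition _ :=
  GRing.isSubmodClosed.Build R[i] (I -> R[i]) square_summable
    square_summable_submod_closed.

End ell2.

(* For I = K this is the Hilbert space of graded-holomorphic functions, i.e.
   L^2 of the (trace-inverse-limit) adele class group of K: [a] stands for the
   series F = \sum_(alpha in K) a_alpha rho^alpha, whose boundary value is
   \sum_(alpha in K) a_alpha phi_alpha. *)
Record ell2 (R : realType) (I : choiceType) := Ell2 {
  coef :> I -> R[i];
  coef_square_summable : coef \in square_summable }.

HB.instance Definition _ R I := [isSub for @coef R I].
HB.instance Definition _ R I := [Choice of @ell2 R I by <:].
HB.instance Definition _ R I :=
  [SubChoice_isSubLmodule of @ell2 R I by <:].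

Section ell2_normed.
Context {R : realType} {I : choiceType}.
Implicit Types a b : ell2 R I.

Let norm a : R[i] := (l2norm a)%:C.

Let ler_normD a b : norm (a + b) <= norm a + norm b.
Proof.
rewrite -rmorphD lecR; exact: (l2normD (valP a) (valP b)).2.
Qed.

Let normrZ (c : R[i]) a : norm (c *: a) = `|c| * norm a.
Proof.
by rewrite /norm -[X in X * _]/((cabs c)%:C) -rmorphM/= -(l2normZ c (valP a)).
Qed.

Let normr0_eq0 a : norm a = 0 -> a = 0.
Proof. by move=> [/(l2norm_eq0 (valP a)) a0]; exact: val_inj. Qed.

HB.instance Definition _ :=
  Lmodule_isNormed.Build R[i] (ell2 R I) ler_normD normrZ normr0_eq0.

End ell2_normed.

Section projectivization.
Context {F : numFieldType} {V : normedModType F}.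

(* Quotient of V \ {0}, with the subspace topology, by the scalars F^*. *)
Definition nonzero_vectors : set V := [set v | v <> 0].

Definition proportional (u v : nonzero_vectors) : bool :=
  `[< exists2 c : F, c <> 0 & set_val u = c *: set_val v >].

Lemma proportional_refl : reflexive proportional.
Proof. by move=> u; apply/asboolP; exists 1; [apply/eqP/oner_neq0|rewrite scale1r]. Qed.

Lemma proportional_sym : symmetric proportional.
Proof.
suff h u v : proportional u v -> proportional v u.
  by move=> u v; apply/idP/idP; exact: h.
move=> /asboolP[c /eqP c0 uv]; apply/asboolP; exists c^-1.
  by apply/eqP; rewrite invr_eq0.
by rewrite uv scalerA mulVf// scale1r.
Qed.

Lemma proportional_trans : transitive proportional.
Proof.
move=> v u w /asboolP[c /eqP c0 uv] /asboolP[d /eqP d0 vw].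
apply/asboolP; exists (c * d); first by apply/eqP; rewrite mulf_neq0.
by rewrite uv vw scalerA.
Qed.

Definition proportional_equiv :=
  EquivRel proportional proportional_refl proportional_sym proportional_trans.

Definition projectivization := quotient_topology {eq_quot proportional_equiv}.

(* x = [v]; in particular v is nonzero. *)
Definition is_class_of (v : V) (x : projectivization) : Prop :=
  exists2 u : nonzero_vectors, set_val u = v & \pi u = x.

End projectivization.
Arguments projectivization {F} V.

(* Algebraic over Q, of finite or infinite degree. Characteristic 0 makes
   [ratr] the embedding of Q. *)
Definition algebraic_number_field (K : fieldType) : Prop :=
  [pchar K] =i pred0 /\ forall x : K, algebraicOver (ratr : rat -> K) x.

Definition algebraic_integer (K : fieldType) (x : K) : Prop :=
  integralOver (intr : int -> K) x.

Section nonlinear_field.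
Context {R : realType} {K : fieldType}.

Definition I_K : set (ell2 R K) :=
  [set F | abs_summable F /\ csum F = 0].

(* (H \ I_K) / C^* as a subset of the projectivization. Seen as a type, it
   carries the subspace topology. The class of 0 is excluded since 0 is in
   I_K. *)
Definition N_K : set (projectivization (ell2 R K)) :=
  [set x | exists2 F, ~ I_K F & is_class_of F x].

Definition N_OK : set N_K :=
  [set x | exists2 F : ell2 R K,
    (forall alpha, ~ algebraic_integer alpha -> F alpha = 0) &
    is_class_of F (set_val x)].

(* The terms a_(p.1) b_(p.2) with p.1 * p.2 = alpha, extended by 0. For
   alpha = 0 these are the terms of
   a_0 \sum_(beta != 0) b_beta + b_0 \sum_(beta != 0) a_beta + a_0 b_0. *)
Definition dirichlet_terms (F G : ell2 R K) (alpha : K) (p : K * K) : R[i] :=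
  if p.1 * p.2 == alpha then F p.1 * G p.2 else 0.

(* The product of F and G is defined and equals D. That the coefficients of
   the product are square summable is part of the type of D. For alpha != 0
   the sum converges absolutely by Cauchy-Schwarz. *)
Definition is_dirichlet_product (F G D : ell2 R K) : Prop :=
  abs_summable (dirichlet_terms F G 0) /\
  forall alpha, D alpha = csum (dirichlet_terms F G alpha).

(* The product of the classes x and y is defined, lies in N_K and equals z.
   The choice of representatives is immaterial. *)
Definition is_class_product (x y z : N_K) : Prop :=
  exists F G D : ell2 R K,
    [/\ is_class_of F (set_val x), is_class_of G (set_val y),
        is_class_of D (set_val z) & is_dirichlet_product F G D].

End nonlinear_field.
Arguments N_K : clear implicits.
Arguments N_OK : clear implicits.

(* Main.v *)
Require Import Defs.
From mathcomp Require Import all_boot all_order all_algebra.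
From mathcomp Require Import complex finmap.
From mathcomp Require Import all_classical all_reals all_analysis.
From mathcomp Require Import ring lra.
From mathcomp.analysis.showcase Require summability.

Set Implicit Arguments.
Unset Strict Implicit.
Unset Printing Implicit Defensive.
Import Order.TTheory GRing.Theory Num.Theory.
Import numFieldNormedType.Exports.

Local Open Scope classical_set_scope.
Local Open Scope complex_scope.
Local Open Scope quotient_scope.
Local Open Scope ring_scope.

(** The set [P] consists of the classes of series with finite support and
    nonzero sum of coefficients.

    Such a series [F] has a common denominator: there is a nonzero rational
    integer [d] such that [d * alpha] is an algebraic integer for every [alpha]
    in the support of [F] ([common_denominator]).  The Dirichlet product of the
    single term [rho^d] with [F] is the dilation of [F] by [d], with coefficient
    [F (alpha / d)] at [alpha] ([is_dirichlet_product_delta]).  Its support lies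
    in [O_K], and it has the same coefficient sum as [F], so that it stays
    outside [I_K].  Hence [A = [rho^d]] has the required property.

    Density rests on two facts.  First, a dense set of vectors outside [I_K] has
    a dense image in [N_K], since the projectivization carries the quotient
    topology ([dense_N_K]).  Second, the series of [P] are dense in [ell2]:
    truncating a series to a large finite set approximates it in norm, and if
    the truncation happens to have zero coefficient sum, subtracting a small
    multiple of one term makes the sum nonzero ([finite_support_approx]). *)

(** * Common denominators of algebraic numbers *)

Section DenominatorClearing.
Context {K : fieldType}.

Lemma algebraic_integer_int (z : int) : algebraic_integer (z%:~R : K).
Proof. exact: (@integral_id _ _ (intr : {rmorphism int -> K})). Qed.

(** If [q] has leading coefficient [c] and degree [n > 0], then [c * x] is a root
    of the monic integer polynomial with coefficients [q_i * c ^ (n - 1 - i)] in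
    degrees [i < n]. *)
Lemma integral_lead_coef_mul (q : {poly int}) (x : K) :
  root (map_poly intr q) x -> algebraic_integer ((lead_coef q)%:~R * x).
Proof.
move=> /rootP qx0; set c := lead_coef q.
have : \sum_(i < size q) (q`_i)%:~R * x ^+ i = 0.
  rewrite -[RHS]qx0 (@horner_coef_wide _ (size q)) ?size_poly//.
  by apply: eq_bigr => i _; rewrite coef_map.
case Eq : (size q) => [|n].
  move=> _; have /eqP -> : c == 0 by rewrite lead_coef_eq0 -size_poly_eq0 Eq.
  by rewrite mul0r; exact: (algebraic_integer_int 0).
have cE : q`_n = c by rewrite /c lead_coefE Eq.
rewrite big_ord_recr/= cE => sum0.
(* From here on the degree of [q] is written [n.+1]. *)
case: n => [|n] in Eq cE sum0 *.
  move: sum0; rewrite big_ord0 add0r expr0 mulr1 => ->.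
  by rewrite mul0r; exact: (algebraic_integer_int 0).
pose r : {poly int} := 'X^(n.+1) + \poly_(i < n.+1) (q`_i * c ^+ (n - i)).
exists r.
  rewrite monicE lead_coefDl ?lead_coefXn// size_polyXn.
  by rewrite ltnS size_poly.
rewrite /r rmorphD /= map_polyXn rootE hornerD hornerXn.
rewrite (@horner_coef_wide _ n.+1); last first.
  by rewrite (leq_trans (size_poly _ _))// size_poly.
(* The value of [r] at [c * x] is [c ^ n] times the value of [q] at [x]. *)
apply/eqP; transitivity (c%:~R ^+ n *
    (\sum_(i < n.+1) (q`_i)%:~R * x ^+ i + c%:~R * x ^+ n.+1)); last first.
  by rewrite sum0 mulr0.
rewrite mulrDr addrC mulr_sumr; congr (_ + _).
  apply: eq_bigr => i _; have lin : (i <= n)%N by rewrite -ltnS.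
  rewrite coef_map coef_poly ltn_ord /= intrM rmorphXn/= exprMn.
  have -> : (c%:~R : K) ^+ n = c%:~R ^+ (n - i) * c%:~R ^+ i.
    by rewrite -exprD subnK.
  ring.
by rewrite exprMn exprS; ring.
Qed.

Context (charK : [pchar K] =i pred0).

Lemma intr_eq0_char0 (z : int) : ((z%:~R : K) == 0) = (z == 0).
Proof.
have /pcharf0P natK := charK.
by case: z => n; rewrite ?NegzE ?rmorphN ?oppr_eq0 /= -pmulrn natK.
Qed.

(** If [p = a^-1 *: q] with [q] an integer polynomial, then [q`_i] and
    [a * ratr p`_i] agree in [K]: the denominators of the coefficients of [p]
    are invertible in characteristic 0. *)
Lemma root_int_of_algebraic (x : K) : algebraicOver (ratr : rat -> K) x ->
  exists2 q : {poly int}, q != 0 & root (map_poly intr q) x.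
Proof.
move=> [p p0 /rootP px0]; have [q [a a0 pE]] := rat_poly_scale p.
exists q; first by apply: contraNneq p0 => q0; rewrite pE q0 map_poly0 scaler0.
have coefE i : (q`_i)%:~R = a%:~R * ratr p`_i :> K.
  have d0 : (denq p`_i)%:~R != 0 :> K by rewrite intr_eq0_char0 denq_neq0.
  rewrite /ratr mulrA; apply: (canRL (mulfK d0)); rewrite -!intrM; congr _%:~R.
  apply: (@intr_inj rat); rewrite !intrM numqE pE coefZ coef_map/=.
  by rewrite mulrA mulrA mulfV ?mul1r// intr_eq0.
apply/rootP; rewrite (@horner_coef_wide _ (maxn (size q) (size p))); last first.
  by rewrite (leq_trans (size_poly _ _))// leq_maxl.
under eq_bigr do rewrite coef_map /= coefE -mulrA.
rewrite -mulr_sumr -[RHS](mulr0 (a%:~R : K)) -[in RHS]px0; congr (_ * _).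
rewrite (@horner_coef_wide _ (maxn (size q) (size p))); last first.
  by rewrite (leq_trans (size_poly _ _))// leq_maxr.
apply: eq_bigr => i _; congr (_ * _).
by rewrite coef_map_id0// /ratr mul0r.
Qed.

Lemma common_denominator (S : seq K) :
  (forall x : K, algebraicOver (ratr : rat -> K) x) ->
  exists2 d : int, d != 0 & {in S, forall x, algebraic_integer (d%:~R * x)}.
Proof.
move=> algK; elim: S => [|x S [d d0 dS]]; first by exists 1.
have [q q0 /integral_lead_coef_mul qx] := root_int_of_algebraic (algK x).
exists (d * lead_coef q); first by rewrite mulf_neq0// lead_coef_eq0.
move=> y; rewrite intrM in_cons => /predU1P[->|/dS dy].
  by rewrite -mulrA; apply: integral_mul => //; exact: algebraic_integer_int.
rewrite mulrAC mulrC; apply: integral_mul => //.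
exact: algebraic_integer_int.
Qed.

End DenominatorClearing.

(** * Finitely supported families *)

Section FiniteSupport.
Context {R : realType} {I : choiceType}.
Implicit Types (a : I -> R[i]) (S : {fset I}).

#[local] Existing Instance summability.totally_filter.

(** The family [a] vanishes outside the finite set [S]. *)
Definition supported_in S a : Prop := forall i, i \notin S -> a i = 0.

(** The net of partial sums is constant from [S] on. *)
Lemma partial_sum_supported_in S a (A : {fset I}) : supported_in S a ->
  (S `<=` A)%fset -> summability.partial_sum a A = \sum_(i <- S) a i.
Proof.
move=> aS SA; rewrite /summability.partial_sum.
rewrite -(big_seq_fsetE _ A xpredT a)/=.
by apply/esym; apply: big_fset_incl => // i _ /aS.
Qed.

Lemma csum_supported_in S a : supported_in S a -> csum a = \sum_(i <- S) a i.
Proof.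
move=> aS; rewrite /csum /summability.sum; apply: (@cvg_lim R[i]^o).
  exact: norm_hausdorff.
apply: cvg_near_cst; exists S => // A /= SA.
by rewrite (partial_sum_supported_in aS SA).
Qed.

Lemma sum_fsetU (f : I -> R) (A B : {fset I}) :
  \sum_(i <- (A `|` B)%fset) f i =
  \sum_(i <- A) f i + \sum_(i <- B | i \notin A) f i.
Proof.
rewrite (bigID (mem A))/= big_fset_condE/=; congr (_ + _).
  by apply: eq_fbigl => i; rewrite !inE/=; case: (i \in A); rewrite ?andbF.
rewrite big_fset_condE [RHS]big_fset_condE/=.
by apply: eq_fbigl => i; rewrite !inE/=; case: (i \in A); rewrite ?andbF.
Qed.

Lemma sum_supported_in_le S (f : I -> R) (A : {fset I}) :
  (forall i, 0 <= f i) -> (forall i, i \notin S -> f i = 0) ->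
  \sum_(i <- A) f i <= \sum_(i <- S) f i.
Proof.
move=> f0 fS.
have -> : \sum_(i <- S) f i = \sum_(i <- (A `|` S)%fset) f i.
  by apply: big_fset_incl => [|i _ /fS//]; exact: fsubsetUr.
by rewrite sum_fsetU lerDl sumr_ge0.
Qed.

Lemma abs_summable_supported_in S a : supported_in S a -> abs_summable a.
Proof.
move=> aS.
have aS0 i : i \notin S -> cabs (a i) = 0.
  by move=> /aS ->; rewrite Normc.normc0.
apply: le_lt_trans (ltry (\sum_(i <- S) cabs (a i))).
apply: ge_ereal_sup => _ [A [Afin _] <-].
rewrite fsbig_finite//=.
under eq_bigr do rewrite ger0_norm ?cabs_ge0//.
by rewrite sumEFin lee_fin sum_supported_in_le// => i; exact: cabs_ge0.
Qed.

Lemma square_summable_supported_in S a :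
  supported_in S a -> a \in square_summable.
Proof.
move=> aS; apply: (@l2norm_le _ _ _
  (Num.sqrt (\sum_(i <- S) cabs (a i) ^+ 2)) _ _).1 => [|A Afin].
  exact: sqrtr_ge0.
rewrite sqr_sqrtr ?sumr_ge0// => [|i _]; last exact: sqr_ge0.
apply: sum_supported_in_le => [i|i /aS ->]; first exact: sqr_ge0.
by rewrite Normc.normc0 expr0n.
Qed.

(** A finitely supported family, as an element of [ell2]. *)
Definition ell2_of_support S a (aS : supported_in S a) : ell2 R I :=
  Ell2 (square_summable_supported_in aS).

Lemma supported_in_kronecker (j : I) :
  supported_in [fset j]%fset (fun i => (i == j)%:R : R[i]).
Proof. by move=> i; rewrite inE => /negbTE ->. Qed.

(** The basis vector [rho^j]. *)
Definition delta (j : I) : ell2 R I :=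
  ell2_of_support (@supported_in_kronecker j).

Lemma supported_in_delta j : supported_in [fset j]%fset (delta j).
Proof. exact: supported_in_kronecker. Qed.

Lemma csum_delta j : csum (delta j) = 1.
Proof.
rewrite (csum_supported_in (supported_in_delta (j := j))).
by rewrite big_seq_fset1/= eqxx.
Qed.

Lemma l2norm_delta_le1 j : l2norm (delta j) <= 1.
Proof.
apply: (@l2norm_le _ _ _ _ _ _).2 => // A _.
apply: (@le_trans _ _ (\sum_(i <- [fset j]%fset) cabs (delta j i) ^+ 2)).
  apply: sum_supported_in_le => [i|i ij]; first exact: sqr_ge0.
  by rewrite (supported_in_delta ij) Normc.normc0 expr0n.
by rewrite big_seq_fset1 -[delta j j]/((j == j)%:R) eqxx Normc.normc1 !expr1n.
Qed.

Lemma truncation_approx (F : ell2 R I) (e : R) : 0 < e ->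
  exists S (G : ell2 R I), supported_in S G /\ l2norm (F - G) <= e.
Proof.
move=> e0; have Fss := valP F; have /square_summableP Foo := Fss.
have Fnum : sqnorm F \is a fin_num by rewrite ge0_fin_numE ?sqnorm_ge0.
have e20 : 0 < e ^+ 2 by rewrite exprn_gt0.
(* A finite set [A] carrying all but [e ^ 2] of the squared norm of [F]. *)
have [x [A [Afin _] xE] xlt] := ub_ereal_sup_adherent e20 Fnum.
have {xlt} : (sqnorm F - (e ^+ 2)%:E < x)%E := xlt.
rewrite -xE fsbig_finite//= sumEFin -(fineK Fnum) -EFinB lte_fin => Alt.
set S := fset_set A in Alt.
have GS : supported_in S (fun i => if i \in S then F i else 0).
  by move=> i /negbTE ->.
exists S, (ell2_of_support GS); split => //.
apply: (@l2norm_le _ _ _ _ _ _).2 => [|B Bfin]; first exact: ltW.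
set T := fset_set B.
have -> : \sum_(i <- T) cabs ((F - ell2_of_support GS) i) ^+ 2 =
    \sum_(i <- T | i \notin S) cabs (F i) ^+ 2.
  rewrite [RHS]big_mkcond; apply: eq_bigr => i _.
  rewrite -[(F - _) i]/(F i - (if i \in S then F i else 0)).
  by case: ifPn => iS; rewrite ?subr0// subrr Normc.normc0 expr0n.
(* The sum of [|F|^2] over [B] minus [A] is the sum over the union of [A] and
   [B], which is at most the squared norm, minus the sum over [A]. *)
have ABfin : finite_set (B `|` A) by rewrite finite_setU.
have := sqnorm_sum_le Fss ABfin.
rewrite sqr_sqrtr ?fine_ge0 ?sqnorm_ge0// fset_setU// -/T -/S.
rewrite fsetUC sum_fsetU => h.
by apply: ltW; lra.
Qed.

(** When the truncation has zero sum, a multiple of [delta i0] is subtracted;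
    the index [i0] is arbitrary. *)
Lemma finite_support_approx (i0 : I) (F : ell2 R I) (e : R) : 0 < e ->
  exists S (G : ell2 R I),
    [/\ supported_in S G, csum G <> 0 & l2norm (F - G) < e].
Proof.
move=> e0; have e40 : 0 < e / 4 by rewrite divr_gt0.
have [S [G [GS FG]]] := truncation_approx F e40.
have [G0|/eqP G0] := eqVneq (csum G) 0; last first.
  by exists S, G; split => //; apply: le_lt_trans FG _; lra.
pose H : ell2 R I := (e / 4)%:C *: delta i0.
pose T := (i0 |` S)%fset.
have HT : supported_in T H.
  move=> i; rewrite !inE => /norP[/negbTE ii0 _].
  by rewrite -[H i]/((e / 4)%:C * (i == i0)%:R) ii0 mulr0.
have GT : supported_in T G.
  by move=> i; rewrite !inE => /norP[_ /GS].
have GHT : supported_in T (G - H).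
  by move=> i iT; rewrite -[(G - H) i]/(G i - H i) GT// HT// subr0.
have csumH : csum H = (e / 4)%:C.
  rewrite (csum_supported_in HT) -[RHS]mulr1 -(csum_delta i0).
  rewrite (csum_supported_in (supported_in_delta (j := i0))) mulr_sumr.
  apply/esym/big_fset_incl => [|i _ ij]; first exact: fsubsetUl.
  by rewrite -[LHS]/((e / 4)%:C * delta i0 i) (supported_in_delta ij) mulr0.
exists T, (G - H); split => //.
- rewrite (csum_supported_in GHT) sumrB -(csum_supported_in GT) G0.
  rewrite -(csum_supported_in HT) csumH sub0r; apply/eqP.
  by rewrite oppr_eq0 eq_complex /= eqxx andbT gt_eqF.
- have -> : F - (G - H) = (F - G) + H by rewrite opprB addrCA addrC.
  have [_ FGH] := l2normD (valP (F - G)) (valP H).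
  apply: le_lt_trans FGH _.
  have -> : l2norm (\val H) = e / 4 * l2norm (delta i0).
    rewrite -[\val H]/((e / 4)%:C *: (\val (delta i0))).
    rewrite l2normZ ?(valP (delta i0))//.
    by rewrite /= expr0n addr0 sqrtr_sqr gtr0_norm.
  have := l2norm_delta_le1 i0 => d1.
  have : e / 4 * l2norm (delta i0) <= e / 4 by rewrite ler_piMr// ltW.
  move: FG; rewrite -[l2norm (F - G)]/(l2norm (\val (F - G))); lra.
Qed.

End FiniteSupport.

(** * Classes in the projectivization *)

Section Projective.
Context {R : realType} {K : fieldType}.
Implicit Types F G : ell2 R K.

Lemma I_K0 : I_K (0 : ell2 R K).
Proof.
have S0 : supported_in fset0 (0 : ell2 R K) by [].
split; first exact: abs_summable_supported_in S0.
by rewrite (csum_supported_in S0) big_seq_fset0.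
Qed.

Lemma class_of_notin_I_K F : ~ I_K F ->
  exists x : N_K R K, is_class_of F (set_val x).
Proof.
move=> FI; have F0 : nonzero_vectors F.
  by move=> F0; apply: FI; rewrite F0; exact: I_K0.
pose u : @nonzero_vectors _ (ell2 R K) := SigSub (mem_set F0).
have Fu : is_class_of F (\pi_(projectivization (ell2 R K)) u).
  by exists u.
have xN : N_K R K (\pi_(projectivization (ell2 R K)) u) by exists F.
by exists (SigSub (mem_set xN)).
Qed.

Lemma dense_N_K (A : set (ell2 R K)) :
  (forall F, A F -> ~ I_K F) -> dense A ->
  dense [set x : N_K R K | exists2 F, A F & is_class_of F (set_val x)].
Proof.
(* An open set of [N_K] is the trace of an open [W] of the projectivization,
   and the preimage of [W] is the trace of an open [V] of [ell2]. *)
move=> AI Ad O [x Ox] [W oW WO].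
have [V oV VW] := oW.
have [F0 _ [u uF ux]] := set_valP x.
have VF0 : V (set_val u).
  have : W (set_val x) by move: Ox; rewrite -WO.
  rewrite -[set_val x]ux => Wu.
  have : (\pi_(projectivization (ell2 R K)) @^-1` W) u := Wu.
  by rewrite -VW.
have V0 : V !=set0 by exists (set_val u).
have [G [VG AG]] := Ad V V0 oV.
have [y Gy] := class_of_notin_I_K (AI G AG).
exists y; split; last by exists G.
case: Gy => v vG vy.
suff : W (set_val y) by rewrite -WO.
rewrite -vy; suff : (\pi_(projectivization (ell2 R K)) @^-1` W) v by [].
by rewrite -VW /= vG.
Qed.

(** The representatives of the classes forming the dense set [P]. *)
Definition finite_support_nonzero_sum : set (ell2 R K) :=
  [set F | (exists S, supported_in S F) /\ csum F <> 0].

Lemma dense_finite_support_nonzero_sum : dense finite_support_nonzero_sum.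
Proof.
move=> V [F VF] oV.
have /nbhs_ballP[_ /posnumP[e] eV] : nbhs F V by exact: open_nbhs_nbhs.
(* The radius [e] is a positive complex number, hence equal to its real part. *)
have e0 := [gt0 of e%:num].
have e0R : 0 < complex.Re e%:num by move: e0; rewrite ltcE => /andP[].
have [S [G [GS G0 FG]]] := finite_support_approx 0 F e0R.
exists G; split; last by split => //; exists S.
apply: eV; rewrite -ball_normE /=.
rewrite -[ `|_| ]/((l2norm (F - G))%:C) ltcE /= FG andbT.
by move: e0; rewrite ltcE => /andP[].
Qed.

Lemma not_I_K_csum F : csum F <> 0 -> ~ I_K F.
Proof. by move=> F0 []. Qed.

(** * Dilation as a Dirichlet product *)

Section Dilation.
Context (d : K) (d0 : d != 0) (F : ell2 R K) (S : {fset K}).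
Context (FS : supported_in S F).

Lemma supported_in_dilate :
  supported_in [fset d * i | i in S]%fset (fun i => F (d^-1 * i)).
Proof.
move=> i iS; apply: FS; apply: contra iS => iS.
by apply/imfsetP; exists (d^-1 * i) => //=; rewrite mulVKf.
Qed.

(** The series [sum_alpha F alpha rho^(d * alpha)]. *)
Definition dilate := ell2_of_support supported_in_dilate.

Lemma csum_dilate : csum dilate = csum F.
Proof.
rewrite (csum_supported_in supported_in_dilate) (csum_supported_in FS).
rewrite big_imfset/=; last by move=> x y _ _; exact: mulfI.
by apply: eq_bigr => i _; rewrite mulKf.
Qed.

(** Only the factorization [alpha = d * (alpha / d)] contributes. *)
Lemma supported_in_dirichlet_terms_delta (alpha : K) :
  supported_in [fset (d, d^-1 * alpha)]%fset
    (dirichlet_terms (delta d) F alpha).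
Proof.
move=> [x y]; rewrite inE /dirichlet_terms /= xpair_eqE.
have [->|_ _] := eqVneq x d; last by rewrite mul0r if_same.
by have [<-|//] := eqVneq (d * y) alpha; rewrite mulKf// eqxx.
Qed.

Lemma is_dirichlet_product_delta : is_dirichlet_product (delta d) F dilate.
Proof.
split=> [|alpha].
  exact: abs_summable_supported_in (@supported_in_dirichlet_terms_delta 0).
rewrite (csum_supported_in (@supported_in_dirichlet_terms_delta alpha)).
by rewrite big_seq_fset1 /dirichlet_terms /= mulVKf// !eqxx mul1r.
Qed.

End Dilation.
End Projective.

Theorem theorem7 (R : realType) (K : fieldType)
    (hK : algebraic_number_field K) :
  exists P : set (N_K R K),
    dense P /\
    forall F : N_K R K, P F ->
      exists A : N_K R K, N_OK R K A /\
        exists AF : N_K R K, is_class_product A F AF /\ N_OK R K AF.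
Proof.
have [charK algK] := hK.
exists [set x | exists2 F, finite_support_nonzero_sum F &
                          is_class_of F (set_val x)].
split.
  by apply: dense_N_K dense_finite_support_nonzero_sum => F [_ /not_I_K_csum].
move=> x [F [[S FS] F0] Fx].
have [n n0 nS] := common_denominator charK S algK.
pose d : K := n%:~R.
have d0 : d != 0 by rewrite intr_eq0_char0.
have delta0 : csum (delta d : ell2 R K) <> 0.
  by rewrite csum_delta; apply/eqP/oner_neq0.
have dF0 : csum (dilate d0 FS) <> 0 by rewrite csum_dilate.
have [A dA] := class_of_notin_I_K (not_I_K_csum delta0).
have [AF dAF] := class_of_notin_I_K (not_I_K_csum dF0).
exists A; split.
  exists (delta d) => // alpha aI; apply: supported_in_delta.
  apply/negP; rewrite inE => /eqP aE; apply: aI; rewrite aE.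
  exact: algebraic_integer_int.
exists AF; split.
  exists (delta d), F, (dilate d0 FS); split => //.
  exact: is_dirichlet_product_delta.
exists (dilate d0 FS) => // alpha aI; apply: (supported_in_dilate d0 FS).
by apply/negP => /imfsetP[y /= yS aE]; apply: aI; rewrite aE; exact: nS.
Qed.
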